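(* Let $\alpha_1,\alpha_2,\beta_1,\beta_2>0$, let $\{X(t):t\geq 0\}$ be the continuous-time Markov chain on $\mathbb{Z}$ with alternating rates described in the context, and let $\Lambda$ be the function in the context. Then, for all $k\in\mathbb{Z}$, the family of laws $\left\{P\left(\frac{X(t)}{t}\in\cdot\,\Big|\,X(0)=k\right):t>0\right\}$ on $\mathbb{R}$ satisfies the large deviation principle with speed function $v_t=t$ and good rate function $$\Lambda^*(y):=\sup_{\gamma\in\mathbb{R}}\{\gamma y-\Lambda(\gamma)\}.$$
   Context: $\{X(t):t\geq 0\}$ is the continuous-time Markov chain on $\mathbb{Z}$ whose state probabilities $p_{k,n}(t):=P(X(t)=n|X(0)=k)$ satisfy $p_{k,n}(0)=1_{\{k=n\}}$ and whose generator $g_{k,n}:=\lim_{t\to 0}\frac{p_{k,n}(t)-p_{k,n}(0)}{t}$ is as follows. For even $k$: $g_{k,k+1}=\alpha_1$, $g_{k,k-1}=\alpha_2$, $g_{k,k}=-(\alpha_1+\alpha_2)$. For odd $k$: $g_{k,k+1}=\beta_1$, $g_{k,k-1}=\beta_2$, $g_{k,k}=-(\beta_1+\beta_2)$. All other entries are $0$. For $z>0$, $h(z):=\frac12\sqrt{(\alpha_1+\alpha_2-(\beta_1+\beta_2))^2z^2+4(\beta_1z^2+\beta_2)(\alpha_1z^2+\alpha_2)}$; for $\gamma\in\mathbb{R}$, $\Lambda(\gamma):=\frac{h(e^\gamma)}{e^\gamma}-\frac{\alpha_1+\alpha_2+\beta_1+\beta_2}{2}$. Large deviation principle: a family of probability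 measures $\{\pi_t:t>0\}$ on a topological space $\mathcal{Y}$ satisfies the large deviation principle with rate function $I$ and speed function $v_t$ if $\lim_{t\to+\infty}v_t=+\infty$, $I:\mathcal{Y}\to[0,+\infty]$ is lower semicontinuous, $\liminf_{t\to+\infty}\frac{1}{v_t}\log\pi_t(O)\geq-\inf_{y\in O}I(y)$ for all open sets $O$, and $\limsup_{t\to+\infty}\frac{1}{v_t}\log\pi_t(C)\leq-\inf_{y\in C}I(y)$ for all closed sets $C$. The rate function $I$ is good if all level sets $\{y\in\mathcal{Y}:I(y)\leq\eta\}$, $\eta\geq0$, are compact. *)

(* Defs.v *)
From HB Require Import structures.
From mathcomp Require Import all_boot all_order all_algebra.
From mathcomp Require Import all_classical all_reals all_analysis.

Set Implicit Arguments.
Unset Strict Implicit.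
Unset Printing Implicit Defensive.

Import Order.TTheory GRing.Theory Num.Theory.
Import numFieldNormedType.Exports.

Local Open Scope classical_set_scope.
Local Open Scope ring_scope.

HB.instance Definition _ := isPointed.Build int 0.
HB.instance Definition _ := @isMeasurable.Build default_measure_display
  int discrete_measurable discrete_measurable0
  discrete_measurableC discrete_measurableU.

Definition borel (Y : ptopologicalType) := g_sigma_algebraType (@open Y).

Section large_deviations.
Local Open Scope ereal_scope.

Record satisfies_LDP (R : realType) (Y : ptopologicalType)
    (pi_ : R -> probability (borel Y) R) (v : R -> R) (I : Y -> \bar R) : Prop := {
  LDP_speed : v t @[t --> +oo%R] --> +oo%R ;
  LDP_rate_ge0 : forall y, 0 <= I y ;
  LDP_rate_lsc : lower_semicontinuous I ;
  LDP_lower : forall O : set Y, open O ->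
    - ereal_inf (I @` O) <=
    limf_einf (fun t : R => ((v t)^-1)%:E * lne (pi_ t O)) +oo%R ;
  LDP_upper : forall C : set Y, closed C ->
    limf_esup (fun t : R => ((v t)^-1)%:E * lne (pi_ t C)) +oo%R <=
    - ereal_inf (I @` C)
}.

Definition good_rate (R : realType) (Y : topologicalType) (I : Y -> \bar R) :=
  forall eta : R, (0 <= eta)%R -> compact [set y | I y <= eta%:E].

End large_deviations.

Section markov_chain.
Context (R : realType) d (T : measurableType d).
(* P k stands for the conditional law P( . | X(0) = k).  Only the values of X at
   times t >= 0 are constrained below. *)
Context (P : int -> probability T R) (X : R -> {mfun T >-> int}).

Definition past (s : R) : set (set T) :=
  <<s [set A | exists u i, 0 <= u <= s /\ A = X u @^-1` [set i]] >>.

(* The Markov property P(X(s+t) = n | A, X(s) = j) = P(X(t) = n | X(0) = j) for A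
   in the past of s, cleared of its denominator P(A, X(s) = j). *)
Record markov_chain : Prop := {
  markov_start : forall k, P k (X 0 @^-1` [set k]) = 1%E ;
  markov_property : forall (k j n : int) (s t : R) (A : set T),
    0 <= s -> 0 <= t -> past s A ->
    P k (A `&` X s @^-1` [set j] `&` X (s + t) @^-1` [set n]) =
    (P k (A `&` X s @^-1` [set j]) * P j (X t @^-1` [set n]))%E
}.

Definition state_prob (k n : int) (t : R) : R :=
  fine (P k (X t @^-1` [set n])).

Definition has_generator (g : int -> int -> R) : Prop :=
  forall k n,
    (state_prob k n t - state_prob k n 0) / t @[t --> 0^'+] --> g k n.

Definition scaled_position (t : R) (w : T) : borel R := (X t w)%:~R / t.

Lemma measurable_scaled_position (t : R) :
  measurable_fun setT (scaled_position t).
Proof.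
move=> _ B mB.
rewrite -[_ @^-1` _]/(X t @^-1` [set i : int | B ((i%:~R : R) / t)]).
exact: measurable_funP.
Qed.

HB.instance Definition _ (t : R) :=
  isMeasurableFun.Build _ _ _ _ (scaled_position t)
    (measurable_scaled_position t).

Definition scaled_law (k : int) (t : R) : probability (borel R) R :=
  distribution (P k) (scaled_position t).

End markov_chain.

Section alternating_rates.
Context (R : realType).

Definition alternating_generator (alpha1 alpha2 beta1 beta2 : R)
    (k n : int) : R :=
  let: (up, down) := if (2 %| k)%Z then (alpha1, alpha2) else (beta1, beta2) in
  if n == k + 1 then up
  else if n == k - 1 then down
  else if n == k then - (up + down)
  else 0.

Definition h_fun (alpha1 alpha2 beta1 beta2 : R)
    (z : R) : R :=
  2^-1 * Num.sqrt
    ((alpha1 + alpha2 - (beta1 + beta2)) ^+ 2 * z ^+ 2 +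
     4 * (beta1 * z ^+ 2 + beta2) * (alpha1 * z ^+ 2 + alpha2)).

Definition Lambda (alpha1 alpha2 beta1 beta2 : R)
    (gamma : R) : R :=
  h_fun alpha1 alpha2 beta1 beta2 (expR gamma) / expR gamma -
  (alpha1 + alpha2 + beta1 + beta2) / 2.

End alternating_rates.

Definition legendre (R : realType) (f : R -> R) (y : R) : \bar R :=
  ereal_sup [set (gamma * y - f gamma)%:E | gamma in [set: R]].

(* Main.v *)
(* The generator acts on functions [n |-> e^(g n) u(parity of n)] through a 2x2
   matrix with positive off-diagonal entries whose Perron eigenvalue is
   [Lambda g], so [e^(g n)], corrected by a bounded positive weight depending on
   the parity of [n], has mean [e^(t Lambda g)] times its initial value.
   Superadditivity turns the derivatives at [0] into lower bounds on the
   transition probabilities that are uniform in the starting point; complementing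
   them gives matching upper bounds, and iterating over a mesh [t / N] identifies
   these exponential means, with all sums kept finite.
   The upper bound of the LDP is then Chernoff's inequality on the two half-lines
   cut at [Lambda' 0]. For the lower bound at [y], choose [g] with
   [Lambda' g = y]: under the weight [e^(g n)] the mass concentrates around
   [n / t = y], by Chernoff's inequality for the tilted weights. Convexity of
   [Lambda] is Cauchy-Schwarz, which exhibits [Lambda' g] as a subgradient. *)
Require Import Defs.
From mathcomp Require Import all_boot all_order all_algebra ring lra zify.
From mathcomp Require Import all_classical all_reals all_analysis.

Set Implicit Arguments.
Unset Strict Implicit.
Unset Printing Implicit Defensive.

Import Order.TTheory GRing.Theory Num.Theory.
Import numFieldNormedType.Exports.

Local Open Scope classical_set_scope.
Local Open Scope ring_scope.

(** * Transition probabilities and Chapman-Kolmogorov over finite lists of states *)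

Section transition_probabilities.
Context (R : realType) d (T : measurableType d).
Context (P : int -> probability T R) (X : R -> {mfun T >-> int}).
Hypothesis mc : markov_chain P X.

Local Notation p := (state_prob P X).

Lemma measurable_state_event t (B : set int) : measurable (X t @^-1` B).
Proof. by rewrite -[_ @^-1` _]setTI; exact: measurable_funP. Qed.

#[local] Hint Resolve measurable_state_event : core.

Lemma prob_fin_num k (A : set T) : measurable A -> P k A \is a fin_num.
Proof. exact: fin_num_measure. Qed.

Lemma fine_prob_ge0 k (A : set T) : 0 <= fine (P k A).
Proof. exact: fine_ge0. Qed.

Lemma fine_prob_le k (A B : set T) : measurable A -> measurable B ->
  A `<=` B -> fine (P k A) <= fine (P k B).
Proof.
move=> mA mB AB; apply: fine_le; rewrite ?prob_fin_num//.
by apply: le_measure; rewrite ?inE.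
Qed.

Lemma fine_prob_disjointU k (A B : set T) : measurable A -> measurable B ->
  A `&` B = set0 -> fine (P k (A `|` B)) = fine (P k A) + fine (P k B).
Proof. by move=> mA mB AB; rewrite measureU// fineD ?prob_fin_num. Qed.

Lemma sum_prob_state_event k (E : set T) t (s : seq int) : measurable E ->
  uniq s -> \sum_(n <- s) fine (P k (E `&` X t @^-1` [set n])) =
            fine (P k (E `&` X t @^-1` [set` s])).
Proof.
move=> mE; elim: s => [|n s IH] /=.
  by rewrite big_nil set_nil preimage_set0 setI0 measure0.
move=> /andP[ns us]; rewrite big_cons IH//.
have -> : [set` n :: s] = [set n] `|` [set` s].
  apply/seteqP; split=> i /=; rewrite inE; first by case/orP => [/eqP|]; tauto.
  by case=> [->|->]; rewrite ?eqxx ?orbT.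
rewrite preimage_setU setIUr.
rewrite fine_prob_disjointU//; [exact: measurableI..|].
rewrite -setIIr -preimage_setI (_ : _ `&` [set` s] = set0).
  by rewrite preimage_set0 setI0.
by rewrite -subset0 => i [/= ->]; rewrite (negbTE ns).
Qed.

Lemma state_prob_ge0 k n t : 0 <= p k n t.
Proof. exact: fine_prob_ge0. Qed.

Lemma sum_state_prob k t (s : seq int) : uniq s ->
  \sum_(n <- s) p k n t = fine (P k (X t @^-1` [set` s])).
Proof.
move=> us; under eq_bigr do rewrite /state_prob -[_ @^-1` _]setTI.
by rewrite sum_prob_state_event// setTI.
Qed.

Lemma sum_state_prob_le1 k t (s : seq int) : uniq s ->
  \sum_(n <- s) p k n t <= 1.
Proof.
move=> us; rewrite sum_state_prob// -[leRHS]/(fine 1%:E).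
by rewrite -(probability_setT (P k)); exact: fine_prob_le.
Qed.

Lemma state_prob_joint k j n s t : 0 <= s -> 0 <= t ->
  fine (P k (X s @^-1` [set j] `&` X (s + t) @^-1` [set n])) =
  p k j s * p j n t.
Proof.
move=> s0 t0; rewrite -[X in fine (P k (X `&` _))]setTI.
rewrite (markov_property mc)//; last first.
  rewrite -setC0; apply: sigma_algebraC; exact: sigma_algebra0.
by rewrite setTI fineM ?prob_fin_num.
Qed.

(** By the Markov property each intermediate state in [J] contributes a product; paths outside [J]
    at time [s] are kept as one remainder, which lower bounds drop and upper bounds estimate. All
    sums thus stay finite. *)
Lemma state_prob_split k n s t (J : seq int) : uniq J -> 0 <= s -> 0 <= t ->
  p k n (s + t) = \sum_(j <- J) p k j s * p j n t +
    fine (P k (~` (X s @^-1` [set` J]) `&` X (s + t) @^-1` [set n])).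
Proof.
move=> uJ s0 t0.
under eq_bigr => j _ do rewrite -state_prob_joint// setIC.
rewrite sum_prob_state_event// setIC -fine_prob_disjointU.
- by rewrite -setIUl setUv setTI.
- exact: measurableI.
- by apply: measurableI => //; exact: measurableC.
- by rewrite -setIIl setICr set0I.
Qed.

Lemma chapman_kolmogorov_ge k n s t (J : seq int) :
  uniq J -> 0 <= s -> 0 <= t ->
  \sum_(j <- J) p k j s * p j n t <= p k n (s + t).
Proof.
by move=> uJ s0 t0; rewrite (state_prob_split k n uJ s0 t0) lerDl fine_prob_ge0.
Qed.

(** Paths outside [J] at time [s] carry exactly the mass missing from the sum over [J], and each of
    them that ends in [S] collects at most [M]. *)
Lemma chapman_kolmogorov_le k s t (J S : seq int) (F : int -> R) (M : R) :
  uniq J -> uniq S -> 0 <= s -> 0 <= t -> (forall n, n \in S -> F n <= M) ->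
  0 <= M ->
  \sum_(n <- S) p k n (s + t) * F n <=
  \sum_(j <- J) p k j s * (\sum_(n <- S) p j n t * F n) +
  (1 - \sum_(j <- J) p k j s) * M.
Proof.
move=> uJ uS s0 t0 FM M0.
under eq_bigr => n _ do rewrite (state_prob_split k n uJ s0 t0) mulrDl.
rewrite big_split/=; apply: lerD.
  under eq_bigr => n _ do rewrite mulr_suml.
  rewrite exchange_big/=; apply: ler_sum => j _; rewrite mulr_sumr.
  by apply: ler_sum => n _; rewrite mulrA.
have mJ : measurable (~` (X s @^-1` [set` J])) by exact: measurableC.
have -> : 1 - \sum_(j <- J) p k j s = fine (P k (~` (X s @^-1` [set` J]))).
  by rewrite sum_state_prob// probability_setC// fineB ?prob_fin_num.
apply: (@le_trans _ _ (fine (P k (~` (X s @^-1` [set` J]) `&`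
    X (s + t) @^-1` [set` S])) * M)).
  rewrite -sum_prob_state_event// mulr_suml big_seq [leRHS]big_seq.
  by apply: ler_sum => n nS; rewrite ler_wpM2l ?fine_prob_ge0 ?FM.
by apply: ler_wpM2r => //; apply: fine_prob_le => //; exact: measurableI.
Qed.

Lemma state_prob0 k n : p k n 0 = (k == n)%:R.
Proof.
have p1 : p k k 0 = 1 by rewrite /state_prob (markov_start mc).
case: eqVneq => [<-//|kn]; apply/eqP; rewrite eq_le state_prob_ge0 andbT.
have := @sum_state_prob_le1 k 0 [:: k; n].
by rewrite /= inE kn big_cons big_seq1 p1 gerDl; exact.
Qed.

End transition_probabilities.

(** * Lower bounds on transition probabilities from their derivatives at [0] *)

Lemma right_nbhs_mesh (R : realType) (Q : R -> Prop) (t : R) : 0 < t ->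
  (\forall h \near 0^'+, Q h) -> exists N : nat, Q (t / N.+1%:R).
Proof.
(* Truncation gives [t / e < N.+1], so the mesh [t / N.+1] falls inside the neighbourhood of radius
   [e]. *)
move=> t0 [e /= e0 He]; pose N := Num.truncn (t / e); exists N.
have h0 : 0 < t / N.+1%:R by rewrite divr_gt0.
apply: He => //=; rewrite sub0r normrN gtr0_norm// ltr_pdivrMr// mulrC.
by rewrite -ltr_pdivrMr// truncnS_gt.
Qed.

Section short_time_bounds.
Context (R : realType) d (T : measurableType d).
Context (P : int -> probability T R) (X : R -> {mfun T >-> int}).
Hypothesis mc : markov_chain P X.

Local Notation p := (state_prob P X).

(** Being at [k] at every mesh point is one way to be there at the end, so [p k k] is
    supermultiplicative; the rest is Bernoulli's inequality by induction. *)
Lemma state_prob_stay_mesh k (h c : R) (j : nat) : 0 <= h -> 0 <= c <= 1 ->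
  1 - c <= p k k h -> 1 - j%:R * c <= p k k (j%:R * h).
Proof.
move=> h0 /andP[c0 c1] hc; elim: j => [|j IH].
  by rewrite !mul0r (state_prob0 mc) eqxx subr0.
have jh0 : 0 <= j%:R * h by rewrite mulr_ge0.
have := @chapman_kolmogorov_ge _ _ _ _ _ mc k k h (j%:R * h) [:: k] isT h0 jh0.
rewrite big_seq1 (_ : h + j%:R * h = j.+1%:R * h); last by rewrite -natr1; ring.
apply: le_trans; rewrite -natr1.
(* The two lower bounds can be multiplied only if [1 - j%:R * c] is nonnegative; otherwise the bound
   to prove is at most [0]. *)
have [jc|jc] := lerP 0 (1 - j%:R * c).
  apply: (@le_trans _ _ ((1 - c) * (1 - j%:R * c))); last first.
    by apply: ler_pM => //; rewrite subr_ge0.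
  have : 0 <= j%:R * c * c by rewrite !mulr_ge0.
  by nra.
apply: (@le_trans _ _ 0); last by rewrite mulr_ge0 ?state_prob_ge0.
by rewrite mulrDl mul1r opprD addrA subr_le0 (le_trans (ltW jc)).
Qed.

Lemma state_prob_stay_ge k (q t : R) : 0 <= q -> 0 <= t ->
  (p k k s - p k k 0) / s @[s --> 0^'+] --> - q -> 1 - q * t <= p k k t.
Proof.
move=> q0; rewrite le_eqVlt => /orP[/eqP<- _|t0 lim].
  by rewrite mulr0 subr0 (state_prob0 mc) eqxx.
(* The excess [e / t] of the rate over [q] costs exactly [e] over time [t]. *)
apply/ler_addgt0Pr => e e0; pose c := q + e / t.
have et0 : 0 < e / t by rewrite divr_gt0.
have c0 : 0 < c by rewrite ltr_wpDl.
have [|N [c1 pN h0]] := @right_nbhs_mesh _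
    (fun h => [/\ c * h <= 1, 1 - c * h <= p k k h & 0 < h]) t t0.
  near=> h; have h0 : 0 < h by near: h; exact: nbhs_right_gt.
  split => //.
    rewrite -ler_pdivlMl// mulr1; near: h; apply: nbhs_right_le.
    by rewrite invr_gt0.
  have : - c < (p k k h - p k k 0) / h.
    near: h; apply: (cvgr_gt (- q) lim); rewrite ltrN2 /c ltrDl//.
  rewrite (state_prob0 mc) eqxx ltr_pdivlMr//=; lra.
have cN : 0 <= c * (t / N.+1%:R) <= 1 by rewrite c1 mulr_ge0 ?(ltW c0) ?(ltW h0).
have tN : N.+1%:R * (t / N.+1%:R) = t by rewrite mulrC divfK.
have := state_prob_stay_mesh N.+1 (ltW h0) cN pN.
rewrite mulrCA tN => H; rewrite -lerBlDr (le_trans _ H)//.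
by rewrite /c mulrDl divfK ?gt_eqF//; lra.
Unshelve. all: by end_near. Qed.

(** Split at the first step: either the chain is still at [k] and reaches [n] in the [j] remaining
    steps, or it is already at [n] and is found there at the end. *)
Lemma state_prob_jump_mesh k n (h q a : R) (j : nat) : k != n ->
  0 <= h -> 0 <= a -> 0 <= q -> q * (j%:R * h) <= 1 ->
  (forall s, 0 <= s -> 1 - q * s <= p k k s) ->
  (forall s, 0 <= s -> 1 - q * s <= p n n s) ->
  a <= p k n h -> j%:R * a * (1 - q * (j%:R * h)) <= p k n (j%:R * h).
Proof.
move=> kn h0 a0 q0 + pk pn ha; elim: j => [_|j IH qjh].
  by rewrite !mul0r state_prob_ge0.
have jh0 : 0 <= j%:R * h by rewrite mulr_ge0.
have qh0 : 0 <= q * h by rewrite mulr_ge0.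
have qjh0 : 0 <= j%:R * (q * h) by rewrite mulr_ge0.
have J0 : 0 <= j%:R :> R by [].
have qh1 : q * h + j%:R * (q * h) <= 1 by move: qjh; rewrite -natr1; nra.
have {}IH : j%:R * a * (1 - q * (j%:R * h)) <= p k n (j%:R * h).
  by apply: IH; nra.
have := @chapman_kolmogorov_ge _ _ _ _ _ mc k n h (j%:R * h) [:: k; n].
rewrite /= inE kn => /(_ isT h0 jh0).
rewrite big_cons big_seq1 (_ : h + j%:R * h = j.+1%:R * h); last first.
  by rewrite -natr1; ring.
apply: le_trans; rewrite -natr1.
apply: (@le_trans _ _ ((1 - q * h) * (j%:R * a * (1 - q * (j%:R * h))) +
                       a * (1 - q * (j%:R * h)))).
  rewrite -subr_ge0.
  rewrite (_ : _ - _ = a * (q * h) * (1 + j%:R * (j%:R * (q * h))));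
    last by ring.
  by rewrite !mulr_ge0// addr_ge0// mulr_ge0.
apply: lerD; apply: ler_pM => //.
- by lra.
- by rewrite !mulr_ge0//; lra.
- exact: pk.
- by lra.
- exact: pn.
Qed.

Lemma state_prob_jump_ge k n (g q t : R) : k != n ->
  0 < g -> 0 <= q -> 0 <= t -> q * t <= 1 ->
  (forall s, 0 <= s -> 1 - q * s <= p k k s) ->
  (forall s, 0 <= s -> 1 - q * s <= p n n s) ->
  (p k n s - p k n 0) / s @[s --> 0^'+] --> g ->
  g * t * (1 - q * t) <= p k n t.
Proof.
move=> kn g0 q0; rewrite le_eqVlt => /orP[/eqP<- _ _ _ _|t0 qt pk pn lim].
  by rewrite mulr0 mul0r state_prob_ge0.
suff H (e : R) : 0 < e < g -> (g - e) * t * (1 - q * t) <= p k n t.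
  (* The bound [e / t] keeps the loss over time [t] below [e]; the bound [g / 2] keeps the reduced
     rate positive. *)
  apply/ler_addgt0Pr => e e0; pose e' := Num.min (e / t) (g / 2).
  have e'0 : 0 < e' by rewrite lt_min !divr_gt0.
  have e't : e' * t <= e by rewrite -ler_pdivlMr// ge_min lexx.
  have g2 : g / 2 < g by lra.
  have := H e'; rewrite e'0 gt_min g2 orbT => /(_ isT).
  have : 0 <= (q * t) * (e' * t) by rewrite !mulr_ge0// ltW.
  by nra.
move=> /andP[e0 eg].
have [|N [pN h0]] := @right_nbhs_mesh _
    (fun h => (g - e) * h <= p k n h /\ 0 < h) t t0.
  near=> h; have h0 : 0 < h by near: h; exact: nbhs_right_gt.
  split => //.
  have : g - e < (p k n h - p k n 0) / h.
    by near: h; apply: (cvgr_gt g lim); rewrite ltrBlDr ltrDl.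
  by rewrite (state_prob0 mc) (negbTE kn) subr0 ltr_pdivlMr// => /ltW.
have tE : N.+1%:R * (t / N.+1%:R) = t by rewrite mulrC divfK.
have := @state_prob_jump_mesh k n (t / N.+1%:R) q
  ((g - e) * (t / N.+1%:R)) N.+1 kn (ltW h0).
rewrite [_ * ((g - e) * _)]mulrCA !tE; apply => //.
by rewrite mulr_ge0 ?ltW// subr_gt0.
Unshelve. all: by end_near. Qed.

End short_time_bounds.

(** * The convex function underlying [Lambda], and its slope *)

Section exponential_norm.
Context (R : realType) (E A B : R).
Hypotheses (E0 : 0 <= E) (A0 : 0 < A) (B0 : 0 < B).

(** Euclidean norm of the vector with entries [sqrt E], [sqrt A e^x], [sqrt B e^-x]; [Lambda] has
    this form up to an additive constant. *)
Definition exp_norm (x : R) : R :=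
  Num.sqrt (E + A * expR x ^+ 2 + B * expR (- x) ^+ 2).

(** The derivative of [exp_norm]; it enters through the subgradient inequality and its
    continuity. *)
Definition exp_norm_slope (x : R) : R :=
  (A * expR x ^+ 2 - B * expR (- x) ^+ 2) / exp_norm x.

Lemma exp_norm_arg_gt0 x : 0 < E + A * expR x ^+ 2 + B * expR (- x) ^+ 2.
Proof.
apply: ltr_wpDl; last by apply: mulr_gt0 => //; rewrite exprn_gt0 ?expR_gt0.
by apply: addr_ge0 => //; apply: mulr_ge0; [exact: ltW|exact: sqr_ge0].
Qed.

Lemma exp_norm_gt0 x : 0 < exp_norm x.
Proof. by rewrite sqrtr_gt0 exp_norm_arg_gt0. Qed.

Lemma exp_norm_sqr x :
  exp_norm x ^+ 2 = E + A * expR x ^+ 2 + B * expR (- x) ^+ 2.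
Proof. by rewrite sqr_sqrtr// ltW ?exp_norm_arg_gt0. Qed.

(* By Cauchy-Schwarz [exp_norm x * exp_norm y] dominates
   [E + A e^(x+y) + B e^-(x+y)], which is bounded below by convexity of exp. *)
Lemma exp_norm_subgradient x y :
  exp_norm x + exp_norm_slope x * (y - x) <= exp_norm y.
Proof.
have := exp_norm_gt0 x; have := exp_norm_gt0 y.
have := exp_norm_sqr x; have := exp_norm_sqr y.
rewrite /exp_norm_slope; set r := exp_norm x; set s := exp_norm y.
set a := expR x; set b := expR (- x); set a' := expR y; set b' := expR (- y).
move=> s2 r2 s0 r0.
have [a0 b0 a'0 b'0] : [/\ 0 < a, 0 < b, 0 < a' & 0 < b'].
  by rewrite !expR_gt0.
have a'E : a * (1 + (y - x)) <= a'.
  rewrite (_ : a' = a * expR (y - x)) ?ler_pM2l ?expR_ge1Dx//.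
  by rewrite -expRD; congr expR; ring.
have b'E : b * (1 - (y - x)) <= b'.
  rewrite (_ : b' = b * expR (- (y - x))) ?ler_pM2l ?expR_ge1Dx//.
  by rewrite -expRD; congr expR; ring.
have [A1 B1] : 0 <= A /\ 0 <= B by rewrite !ltW.
have [a1 b1 a'1 b'1] : [/\ 0 <= a, 0 <= b, 0 <= a' & 0 <= b'].
  by rewrite !ltW.
have CS : E + A * (a * a') + B * (b * b') <= r * s.
  rewrite -ler_sqr ?nnegrE; first last.
  - by rewrite mulr_ge0// ltW.
  - by rewrite !(addr_ge0, mulr_ge0).
  rewrite exprMn r2 s2 -subr_ge0.
  rewrite (_ : _ - _ = E * A * (a - a') ^+ 2 + E * B * (b - b') ^+ 2 +
    A * B * (a * b' - a' * b) ^+ 2); last by ring.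
  by rewrite !(sqr_ge0, addr_ge0, mulr_ge0).
rewrite -(ler_pM2l r0) (le_trans _ CS)// mulrDr -expr2 r2.
have -> : r * ((A * a ^+ 2 - B * b ^+ 2) / r * (y - x)) =
    (A * a ^+ 2 - B * b ^+ 2) * (y - x) by field; exact: lt0r_neq0.
have : 0 <= A * a * (a' - a * (1 + (y - x))).
  by rewrite !mulr_ge0// subr_ge0.
have : 0 <= B * b * (b' - b * (1 - (y - x))).
  by rewrite !mulr_ge0// subr_ge0.
by lra.
Qed.

Lemma continuous_expR_sqr (c : R) : continuous (fun x : R => c * expR x ^+ 2).
Proof. by move=> x; apply: cvgMr; apply: cvgM; exact: continuous_expR. Qed.

Lemma continuous_expRN_sqr (c : R) :
  continuous (fun x : R => c * expR (- x) ^+ 2).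
Proof.
move=> x; apply: (@continuous_comp _ _ _ -%R (fun y : R => c * expR y ^+ 2)).
  exact: opp_continuous.
exact: continuous_expR_sqr.
Qed.

Lemma exp_norm_continuous : continuous exp_norm.
Proof.
move=> x; apply: (@continuous_comp _ _ _
  (fun x => E + A * expR x ^+ 2 + B * expR (- x) ^+ 2)
  (@Num.sqrt R : R -> R)); last exact: sqrt_continuous.
apply: cvgD; last exact: continuous_expRN_sqr.
by apply: cvgD; [exact: cvg_cst|exact: continuous_expR_sqr].
Qed.

Lemma exp_norm_slope_continuous : continuous exp_norm_slope.
Proof.
move=> x; apply: cvgM; last first.
  by apply: cvgV; [rewrite gt_eqF ?exp_norm_gt0|exact: exp_norm_continuous].
by apply: cvgB; [exact: continuous_expR_sqr|exact: continuous_expRN_sqr].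
Qed.

(** At [x = ln z] with [z >= 1] the numerator is at least [A z^2 - B] while the denominator is at
    most [C z]. The chosen [z] makes [A z^2] equal to [z (A + |y| C + B)], which covers both
    [|y| C z] and [B]. *)
Lemma exp_norm_slope_unbounded (y : R) : exists2 x, 0 <= x & y <= exp_norm_slope x.
Proof.
pose C := Num.sqrt (E + A + B); pose z := 1 + (`|y| * C + B) / A.
have C0 : 0 <= C by rewrite sqrtr_ge0.
have z1 : 1 <= z.
  by rewrite lerDl divr_ge0 ?addr_ge0 ?mulr_ge0 ?normr_ge0// ltW.
have z0 : 0 < z by rewrite (lt_le_trans _ z1).
exists (ln z); first by rewrite ln_ge0.
rewrite /exp_norm_slope ler_pdivlMr ?exp_norm_gt0//.
rewrite expRN lnK ?posrE//.
have zV : 0 <= z^-1 <= 1 by rewrite invr_ge0 ltW//= invf_le1.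
have rC : exp_norm (ln z) <= C * z.
  rewrite -[X in _ * X](ger0_norm (ltW z0)) -sqrtr_sqr -sqrtrM; last first.
    by rewrite !addr_ge0// ltW.
  rewrite ler_wsqrtr// expRN lnK ?posrE// !mulrDl.
  have z21 : 1 <= z ^+ 2 by rewrite exprn_ege1.
  have zV1 : z^-1 ^+ 2 <= 1 by case/andP: zV => ? ?; rewrite exprn_ile1.
  apply: lerD; first by rewrite lerD2r ler_peMr.
  by rewrite ler_pM2l// (le_trans zV1).
apply: (@le_trans _ _ (`|y| * (C * z))).
  apply: (@le_trans _ _ (`|y| * exp_norm (ln z))).
    by rewrite ler_wpM2r ?ler_norm// ltW ?exp_norm_gt0.
  by rewrite ler_wpM2l.
have -> : A * z ^+ 2 = z * A + z * (`|y| * C + B).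
  rewrite expr2 {1}/z; field; exact: lt0r_neq0.
have : B * z^-1 ^+ 2 <= B.
  by rewrite ler_piMr ?(ltW B0)//; case/andP: zV => ? ?; rewrite exprn_ile1.
have : 0 <= z * A by rewrite mulr_ge0// ltW.
have : B <= z * B by rewrite ler_peMl// ltW.
by lra.
Qed.

End exponential_norm.

Lemma exp_normN (R : realType) (E A B x : R) :
  exp_norm E A B (- x) = exp_norm E B A x.
Proof. by rewrite /exp_norm opprK -addrA (addrC (A * _)) addrA. Qed.

Lemma exp_norm_slopeN (R : realType) (E A B x : R) :
  exp_norm_slope E A B (- x) = - exp_norm_slope E B A x.
Proof. by rewrite /exp_norm_slope exp_normN opprK -[RHS]mulNr opprB. Qed.

(** Reflection swaps [A] and [B] and negates the slope, so unboundedness above also gives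
    unboundedness below; the intermediate value theorem does the rest. *)
Lemma exp_norm_slope_surj (R : realType) (E A B y : R) :
  0 <= E -> 0 < A -> 0 < B -> exists x, exp_norm_slope E A B x = y.
Proof.
move=> E0 A0 B0.
have [b b0 yb] := exp_norm_slope_unbounded E0 A0 B0 y.
have [a a0 ya] := exp_norm_slope_unbounded E0 B0 A0 (- y).
have ab : - a <= b by lra.
have [||c _ <-] := @IVT R (exp_norm_slope E A B) (- a) b y ab; last by exists c.
  by apply: continuous_subspaceT; exact: exp_norm_slope_continuous.
rewrite exp_norm_slopeN ge_min le_max yb orbT andbT lerNl ya//.
Qed.

(** * Convexity, slopes and characteristic equation of [Lambda] *)

Section alternating_cumulant.
Context (R : realType) (alpha1 alpha2 beta1 beta2 : R).
Hypotheses (a1 : 0 < alpha1) (a2 : 0 < alpha2) (b1 : 0 < beta1) (b2 : 0 < beta2).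

(** Dividing the radicand of [h_fun] by [(2 z)^2] leaves [E + A z^2 + B z^-2]. *)
Let E := ((alpha1 + alpha2 - (beta1 + beta2)) / 2) ^+ 2 +
         (alpha1 * beta2 + alpha2 * beta1).
Let A := alpha1 * beta1.
Let B := alpha2 * beta2.
Let L := Lambda alpha1 alpha2 beta1 beta2.

Let E0 : 0 <= E.
Proof. by rewrite addr_ge0 ?sqr_ge0// addr_ge0// mulr_ge0// ltW. Qed.
Let A0 : 0 < A. Proof. exact: mulr_gt0. Qed.
Let B0 : 0 < B. Proof. exact: mulr_gt0. Qed.

Lemma LambdaE g :
  L g = exp_norm E A B g - (alpha1 + alpha2 + beta1 + beta2) / 2.
Proof.
congr (_ - _); rewrite /h_fun /exp_norm expRN; set z := expR g.
have z0 : 0 < z by exact: expR_gt0.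
set N := (X in Num.sqrt X); set M := (X in _ = Num.sqrt X).
have -> : N = (2 * z) ^+ 2 * M by rewrite /N /M /E /A /B; field; exact: lt0r_neq0.
rewrite sqrtrM ?sqr_ge0// sqrtr_sqr ger0_norm; last by rewrite mulr_ge0// ltW.
by field; exact: lt0r_neq0.
Qed.

Definition Lambda_slope (g : R) : R := exp_norm_slope E A B g.

Lemma Lambda_subgradient x y : L x + Lambda_slope x * (y - x) <= L y.
Proof.
have := exp_norm_subgradient E0 A0 B0 x y.
by rewrite !LambdaE /Lambda_slope; lra.
Qed.

Lemma Lambda_slope_continuous : continuous Lambda_slope.
Proof. exact: exp_norm_slope_continuous. Qed.

Lemma Lambda_slope_surj y : exists g, Lambda_slope g = y.
Proof. exact: exp_norm_slope_surj. Qed.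

(** With [a] and [b] the exit rates at even and odd sites, the radicand at [0] is
    [((a - b) / 2)^2 + a b], the square of [(a + b) / 2]. *)
Lemma Lambda0 : L 0 = 0.
Proof.
rewrite LambdaE /exp_norm oppr0 expR0 (_ : E + _ + _ =
  ((alpha1 + alpha2 + beta1 + beta2) / 2) ^+ 2); last first.
  by rewrite /E /A /B; field.
by rewrite sqrtr_sqr ger0_norm ?subrr// divr_ge0// !addr_ge0// ltW.
Qed.

(** The norm strictly exceeds half the difference of the two exit rates. This makes the odd
    component of the Perron eigenvector positive. *)
Lemma Lambda_shift_gt0 g : 0 < L g + (alpha1 + alpha2).
Proof.
have := exp_norm_gt0 E0 A0 B0 g; have := exp_norm_sqr E0 A0 B0 g.
rewrite LambdaE; set r := exp_norm _ _ _ g => rE r0.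
have rE' : ((alpha1 + alpha2 - (beta1 + beta2)) / 2) ^+ 2 < r ^+ 2.
  rewrite rE /E -!addrA ltrDl !addr_gt0// ?mulr_gt0// ?exprn_gt0 ?expR_gt0//.
have : `|(alpha1 + alpha2 - (beta1 + beta2)) / 2| < r.
  by rewrite -(gtr0_norm r0) -ltr_sqr ?nnegrE ?normr_ge0// !real_normK ?num_real.
by rewrite ltr_norml => /andP[+ _]; lra.
Qed.

(* Characteristic equation of the 2x2 matrix through which the generator acts on
   functions [n |-> e^(g n) u(parity of n)]. *)
Lemma Lambda_perron g :
  (beta1 * expR g + beta2 * expR (- g)) * (alpha1 * expR g + alpha2 * expR (- g)) =
  (L g + (beta1 + beta2)) * (L g + (alpha1 + alpha2)).
Proof.
have := exp_norm_sqr E0 A0 B0 g; rewrite LambdaE expRN; set r := exp_norm _ _ _ g.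
have z0 : expR g != 0 by rewrite gt_eqF ?expR_gt0.
move=> rE; transitivity (r ^+ 2 - ((alpha1 + alpha2 - (beta1 + beta2)) / 2) ^+ 2).
  by rewrite rE /E /A /B; field.
by field.
Qed.

End alternating_cumulant.

(** * Exponential means of the chain through an eigenfunction of its generator *)

Section exponential_means.
Context (R : realType) d (T : measurableType d).
Context (alpha1 alpha2 beta1 beta2 : R).
Context (P : int -> probability T R) (X : R -> {mfun T >-> int}).
Hypotheses (a1 : 0 < alpha1) (a2 : 0 < alpha2) (b1 : 0 < beta1) (b2 : 0 < beta2).
Hypothesis mc : markov_chain P X.
Hypothesis gen :
  has_generator P X (alternating_generator alpha1 alpha2 beta1 beta2).

Local Notation p := (state_prob P X).
Local Notation L := (Lambda alpha1 alpha2 beta1 beta2).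
Local Notation q := (alpha1 + alpha2 + beta1 + beta2).

Definition up_rate (k : int) : R := if (2 %| k)%Z then alpha1 else beta1.
Definition down_rate (k : int) : R := if (2 %| k)%Z then alpha2 else beta2.

Definition perron_weight (g : R) (n : int) : R :=
  expR (g * n%:~R) * (if (2 %| n)%Z then alpha1 * expR g + alpha2 * expR (- g)
                      else L g + (alpha1 + alpha2)).
Local Notation w := perron_weight.

Lemma up_rate_gt0 k : 0 < up_rate k.
Proof. by rewrite /up_rate; case: ifP. Qed.

Lemma down_rate_gt0 k : 0 < down_rate k.
Proof. by rewrite /down_rate; case: ifP. Qed.

Lemma total_rate_le k : up_rate k + down_rate k <= q.
Proof. by move: a1 a2 b1 b2; rewrite /up_rate /down_rate; case: ifP => _; lra. Qed.

Lemma even_succz k : (2 %| k + 1)%Z = ~~ (2 %| k)%Z.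
Proof. lia. Qed.

Lemma even_predz k : (2 %| k - 1)%Z = ~~ (2 %| k)%Z.
Proof. lia. Qed.

(** At even sites this holds by the choice of the two parity components; at odd sites it is the
    characteristic equation [Lambda_perron]. The weight is thus an eigenfunction of the generator
    for [L g]. *)
Lemma perron_weight_eigen g k :
  up_rate k * w g (k + 1) + down_rate k * w g (k - 1) =
  (L g + (up_rate k + down_rate k)) * w g k.
Proof.
rewrite /perron_weight even_succz even_predz rmorphD rmorphB /=.
rewrite !mulrDr mulrN mulr1 !expRD.
rewrite /up_rate /down_rate; case: ifP => _ /=; first by ring.
have := Lambda_perron a1 a2 b1 b2 g.
set e := expR g; set f := expR (- g); set z := expR (g * _) => H.
have -> : beta1 * (z * e * (alpha1 * e + alpha2 * f)) +
  beta2 * (z * f * (alpha1 * e + alpha2 * f)) =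
  z * ((beta1 * e + beta2 * f) * (alpha1 * e + alpha2 * f)) by ring.
by rewrite H; ring.
Qed.

Lemma perron_weight_gt0 g n : 0 < w g n.
Proof.
rewrite mulr_gt0 ?expR_gt0//; case: ifP => _; last exact: Lambda_shift_gt0.
by rewrite addr_gt0// mulr_gt0// expR_gt0.
Qed.

(** The parity factor takes only two positive values, so the weight and the plain exponential can be
    exchanged at the cost of constants. *)
Lemma perron_weight_bounds g : exists c C, [/\ 0 < c, 0 < C &
  forall n, c * expR (g * n%:~R) <= w g n <= C * expR (g * n%:~R)].
Proof.
set u := alpha1 * expR g + alpha2 * expR (- g).
set v := L g + (alpha1 + alpha2).
have u0 : 0 < u by rewrite addr_gt0// mulr_gt0// expR_gt0.
have v0 : 0 < v by exact: Lambda_shift_gt0.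
exists (Num.min u v), (Num.max u v); split.
- by rewrite lt_min u0.
- by rewrite lt_max u0.
- move=> n; rewrite /perron_weight -/u -/v ![_ * expR _]mulrC.
  rewrite !ler_pM2l ?expR_gt0//.
  by case: ifP => _; rewrite ?ge_min ?le_max lexx ?orbT.
Qed.

Lemma exit_rateE k :
  alternating_generator alpha1 alpha2 beta1 beta2 k k = - (up_rate k + down_rate k).
Proof.
have k1 : (k == k + 1) = false by lia.
have k2 : (k == k - 1) = false by lia.
rewrite /alternating_generator /up_rate /down_rate.
by case: ifP; rewrite k1 k2 eqxx.
Qed.

Lemma up_rateE k :
  alternating_generator alpha1 alpha2 beta1 beta2 k (k + 1) = up_rate k.
Proof.
by rewrite /alternating_generator /up_rate; case: ifP => _; rewrite eqxx.
Qed.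

Lemma down_rateE k :
  alternating_generator alpha1 alpha2 beta1 beta2 k (k - 1) = down_rate k.
Proof.
have k1 : (k - 1 == k + 1) = false by lia.
by rewrite /alternating_generator /down_rate; case: ifP; rewrite k1 eqxx.
Qed.

Let q0 : 0 < q. Proof. by rewrite !addr_gt0. Qed.

Lemma stay_prob_ge k t : 0 <= t -> 1 - (up_rate k + down_rate k) * t <= p k k t.
Proof.
move=> t0; apply: (state_prob_stay_ge mc) => //.
  by rewrite addr_ge0 ?ltW ?up_rate_gt0 ?down_rate_gt0.
by rewrite -exit_rateE; exact: gen.
Qed.

Lemma stay_prob_ge_unif k t : 0 <= t -> 1 - q * t <= p k k t.
Proof.
move=> t0; apply: le_trans (stay_prob_ge k t0).
by rewrite lerD2l lerN2 ler_wpM2r ?total_rate_le.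
Qed.

Lemma up_prob_ge k t : 0 <= t -> q * t <= 1 ->
  up_rate k * t * (1 - q * t) <= p k (k + 1) t.
Proof.
move=> t0 qt; apply: (state_prob_jump_ge mc) => //.
- by lia.
- exact: up_rate_gt0.
- exact: ltW.
- exact: stay_prob_ge_unif.
- exact: stay_prob_ge_unif.
- by rewrite -up_rateE; exact: gen.
Qed.

Lemma down_prob_ge k t : 0 <= t -> q * t <= 1 ->
  down_rate k * t * (1 - q * t) <= p k (k - 1) t.
Proof.
move=> t0 qt; apply: (state_prob_jump_ge mc) => //.
- by lia.
- exact: down_rate_gt0.
- exact: ltW.
- exact: stay_prob_ge_unif.
- exact: stay_prob_ge_unif.
- by rewrite -down_rateE; exact: gen.
Qed.

Let uniq_nbrs (k : int) : uniq [:: k; k + 1; k - 1].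
Proof. by rewrite /= !inE; lia. Qed.

(** The first-order lower bounds on the three probabilities are inserted and the eigenvalue equation
    is applied; bounding the exit rate at [k] by [q] makes the second-order error independent of
    [k]. *)
Lemma one_step_mean_ge g k h : 0 <= h -> q * h <= 1 ->
  (1 + h * L g - q * h ^+ 2 * (L g + q)) * w g k <=
  \sum_(j <- [:: k; k + 1; k - 1]) p k j h * w g j.
Proof.
move=> h0 qh; rewrite !big_cons big_nil addr0.
have W n : 0 <= w g n by rewrite ltW ?perron_weight_gt0.
apply: (@le_trans _ _ ((1 - (up_rate k + down_rate k) * h) * w g k +
  (up_rate k * h * (1 - q * h) * w g (k + 1) +
   down_rate k * h * (1 - q * h) * w g (k - 1)))); last first.
  by rewrite !lerD// ler_wpM2r// ?stay_prob_ge ?up_prob_ge ?down_prob_ge.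
have -> : (1 - (up_rate k + down_rate k) * h) * w g k +
  (up_rate k * h * (1 - q * h) * w g (k + 1) +
   down_rate k * h * (1 - q * h) * w g (k - 1)) =
  (1 - (up_rate k + down_rate k) * h) * w g k +
  h * (1 - q * h) * (up_rate k * w g (k + 1) + down_rate k * w g (k - 1)) by ring.
rewrite perron_weight_eigen [_ * (_ * w g k)]mulrA -mulrDl ler_wpM2r// -subr_ge0.
rewrite (_ : _ - _ = q * h ^+ 2 * (q - (up_rate k + down_rate k))); last by ring.
by rewrite !mulr_ge0 ?sqr_ge0 ?subr_ge0 ?total_rate_le// ltW.
Qed.

(** Only nearest-neighbour moves are counted at each step, so [N] steps remain within distance [N]
    of [k], and [S] sees all of them. *)
Lemma mesh_mean_ge (g h r : R) (N : nat) (k : int) (S : seq int) :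
  0 <= h -> q * h <= 1 -> 0 <= r ->
  r <= 1 + h * L g - q * h ^+ 2 * (L g + q) ->
  uniq S -> (forall n : int, `|n - k| <= N%:Z -> n \in S) ->
  r ^+ N * w g k <= \sum_(n <- S) p k n (N%:R * h) * w g n.
Proof.
move=> h0 qh r0 rh uS.
have W n : 0 <= w g n by rewrite ltW ?perron_weight_gt0.
elim: N k => [|N IH] k NS.
  have kS : k \in S by apply: NS; lia.
  rewrite expr0 mul0r (bigD1_seq k)//= (state_prob0 mc) eqxx lerDl sumr_ge0//.
  by move=> n _; rewrite mulr_ge0 ?state_prob_ge0.
have Nh0 : 0 <= N%:R * h by rewrite mulr_ge0.
have -> : N.+1%:R * h = h + N%:R * h by rewrite -natr1; ring.
pose J := [:: k; k + 1; k - 1].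
apply: (@le_trans _ _ (\sum_(n <- S)
    (\sum_(j <- J) p k j h * p j n (N%:R * h)) * w g n)); last first.
  apply: ler_sum => n _; rewrite ler_wpM2r// (chapman_kolmogorov_ge mc)//.
  exact: uniq_nbrs.
under eq_bigr do rewrite mulr_suml.
rewrite exchange_big/=.
apply: (@le_trans _ _ (\sum_(j <- J) p k j h * (r ^+ N * w g j))).
  under eq_bigr do rewrite mulrCA.
  rewrite -mulr_sumr exprSr -mulrA ler_wpM2l ?exprn_ge0//.
  by apply: le_trans (one_step_mean_ge g k h0 qh); rewrite ler_wpM2r.
rewrite big_seq [leRHS]big_seq; apply: ler_sum => j jJ.
under eq_bigr do rewrite -mulrA.
rewrite -mulr_sumr ler_wpM2l ?state_prob_ge0// IH// => n nj.
by apply: NS; move: jJ; rewrite !inE; lia.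
Qed.

(** Total mass at most [1] turns the lower bounds on the neighbours into control of everything else:
    at each step the unaccounted mass is of order [h^2] and is charged the largest weight [M]. *)
Lemma mesh_mean_le (g h : R) (N : nat) (k : int) (S : seq int) (M : R) :
  0 <= h -> q * h <= 1 -> uniq S -> 0 <= M -> (forall n, n \in S -> w g n <= M) ->
  \sum_(n <- S) p k n (N%:R * h) * w g n <=
  expR (N%:R * (h * L g)) * w g k + N%:R * (q ^+ 2 * h ^+ 2 * M).
Proof.
move=> h0 qh uS M0 wM.
have W n : 0 <= w g n by rewrite ltW ?perron_weight_gt0.
elim: N k => [|N IH] k.
  rewrite !mul0r expR0 mul1r addr0; have [kS|kS] := boolP (k \in S).
    rewrite (bigD1_seq k)//= (state_prob0 mc) eqxx mul1r big1 ?addr0// => n nk.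
    by rewrite (state_prob0 mc) eq_sym (negbTE nk) mul0r.
  rewrite big_seq big1 // => n nS; rewrite (state_prob0 mc).
  by case: eqVneq nS kS => [->->//|]; rewrite mul0r.
have Nh0 : 0 <= N%:R * h by rewrite mulr_ge0.
have -> : N.+1%:R * h = h + N%:R * h by rewrite -natr1; ring.
apply: le_trans (chapman_kolmogorov_le mc k (uniq_nbrs k) uS h0 Nh0 wM M0) _.
pose b j := \sum_(n <- S) p j n (N%:R * h) * w g n.
have bM j : b j <= M.
  apply: (@le_trans _ _ ((\sum_(n <- S) p j n (N%:R * h)) * M)).
    rewrite mulr_suml /b big_seq [leRHS]big_seq; apply: ler_sum => n nS.
    by rewrite ler_wpM2l ?state_prob_ge0 ?wM.
  by rewrite ler_piMl// sum_state_prob_le1.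
rewrite !big_cons !big_nil -!/(b _) !addr0.
set l0 := 1 - (up_rate k + down_rate k) * h.
set l1 := up_rate k * h * (1 - q * h).
set l2 := down_rate k * h * (1 - q * h).
set x := expR (N%:R * (h * L g)); set y := N%:R * (q ^+ 2 * h ^+ 2 * M) in IH.
have qk := total_rate_le k; have [u0 v0] := (up_rate_gt0 k, down_rate_gt0 k).
have qh' : 0 <= 1 - q * h by rewrite subr_ge0.
have l0_ge0 : 0 <= l0 by rewrite subr_ge0 (le_trans _ qh)// ler_wpM2r.
have l1_ge0 : 0 <= l1 by rewrite !mulr_ge0// ltW.
have l2_ge0 : 0 <= l2 by rewrite !mulr_ge0// ltW.
have l_sum : 1 - (l0 + (l1 + l2)) = q * h ^+ 2 * (up_rate k + down_rate k).
  by rewrite /l0 /l1 /l2; ring.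
(* Since [b c <= M], replacing a probability by its lower bound and charging the difference at [M]
   only increases the estimate. *)
have excess a l c : l <= a -> a * b c + (1 - a) * M <= l * b c + (1 - l) * M.
  move=> la; rewrite -subr_ge0 (_ : _ - _ = (a - l) * (M - b c)); last by ring.
  by rewrite mulr_ge0// subr_ge0.
have e0 := excess _ _ k (stay_prob_ge k h0).
have e1 := excess _ _ (k + 1) (up_prob_ge k h0 qh).
have e2 := excess _ _ (k - 1) (down_prob_ge k h0 qh).
have i0 : l0 * b k <= l0 * (x * w g k + y).
  by apply: ler_wpM2l => //; exact: IH.
have i1 : l1 * b (k + 1) <= l1 * (x * w g (k + 1) + y).
  by apply: ler_wpM2l => //; exact: IH.
have i2 : l2 * b (k - 1) <= l2 * (x * w g (k - 1) + y).
  by apply: ler_wpM2l => //; exact: IH.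
rewrite -/l0 -/l1 -/l2 in e0 e1 e2.
have y0 : 0 <= y by rewrite /y !(sqr_ge0, mulr_ge0).
have z0 : 0 <= 1 - (l0 + (l1 + l2)).
  rewrite l_sum mulr_ge0//; last by rewrite addr_ge0// ltW.
  by rewrite mulr_ge0 ?sqr_ge0// ltW.
have zM : (1 - (l0 + (l1 + l2))) * M <= q ^+ 2 * h ^+ 2 * M.
  rewrite ler_wpM2r// l_sum expr2 mulrAC ler_wpM2r ?sqr_ge0//.
  by rewrite ler_wpM2l// ltW.
have zy : 0 <= (1 - (l0 + (l1 + l2))) * y by rewrite mulr_ge0.
(* By the eigenvalue equation the main part is at most [1 + h * L g] times the weight, since the
   factors [1 - q * h] only decrease it. *)
have lw : l0 * w g k + l1 * w g (k + 1) + l2 * w g (k - 1) <=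
          expR (h * L g) * w g k.
  apply: (@le_trans _ _ ((1 + h * L g) * w g k)); last first.
    by rewrite ler_wpM2r ?expR_ge1Dx.
  rewrite -subr_ge0; have E := perron_weight_eigen g k.
  rewrite (_ : _ - _ = h * ((L g + (up_rate k + down_rate k)) * w g k) -
     h * (1 - q * h) * (up_rate k * w g (k + 1) + down_rate k * w g (k - 1)));
    last by rewrite /l0 /l1 /l2; ring.
  rewrite -E (_ : _ - _ = q * h ^+ 2 *
    (up_rate k * w g (k + 1) + down_rate k * w g (k - 1))); last by ring.
  rewrite mulr_ge0//; first by rewrite mulr_ge0 ?sqr_ge0// ltW.
  by rewrite addr_ge0// mulr_ge0// ltW.
have xlw := ler_wpM2l (expR_ge0 (N%:R * (h * L g))) lw; rewrite -/x in xlw.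
have -> : expR (N.+1%:R * (h * L g)) = x * expR (h * L g).
  by rewrite -expRD -natr1; congr expR; ring.
have -> : N.+1%:R * (q ^+ 2 * h ^+ 2 * M) = y + q ^+ 2 * h ^+ 2 * M.
  by rewrite -natr1 mulrDl mul1r.
move: (q ^+ 2 * h ^+ 2 * M) zM => z zM.
move: (p k k h) (p k (k + 1) h) (p k (k - 1) h) e0 e1 e2 => p0 p1 p2 e0 e1 e2.
move: (b k) (b (k + 1)) (b (k - 1)) e0 e1 e2 i0 i1 i2 => ? ? ? e0 e1 e2 i0 i1 i2.
move: (w g k) (w g (k + 1)) (w g (k - 1)) xlw i0 i1 i2 => ? ? ? xlw i0 i1 i2.
move: (expR (h * L g)) xlw => ? xlw.
lra.
Qed.

(** [M] depends on the finite list [S] but not on the mesh, so the accumulated error [h t q^2 M]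
    vanishes as [h] tends to [0]. *)
Lemma perron_mean_le g t k (S : seq int) : 0 <= t -> uniq S ->
  \sum_(n <- S) p k n t * w g n <= expR (t * L g) * w g k.
Proof.
rewrite le_eqVlt => /orP[/eqP<-|t0] uS.
  have := @mesh_mean_le g 0 0 k S (\sum_(n <- S) w g n) (lexx _).
  rewrite !mul0r !addr0; apply=> //; first by rewrite mulr0.
    by rewrite sumr_ge0// => n _; rewrite ltW ?perron_weight_gt0.
  move=> n nS; rewrite (bigD1_seq n)//= lerDl sumr_ge0// => i _.
  by rewrite ltW ?perron_weight_gt0.
pose M := \sum_(n <- S) w g n.
have M0 : 0 <= M by rewrite sumr_ge0// => n _; rewrite ltW ?perron_weight_gt0.
have wM n : n \in S -> w g n <= M.
  move=> nS; rewrite /M (bigD1_seq n)//= lerDl sumr_ge0// => i _.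
  by rewrite ltW ?perron_weight_gt0.
apply/ler_addgt0Pr => e e0; pose K := t * (q ^+ 2 * M).
have K0 : 0 <= K by rewrite mulr_ge0 ?(ltW t0)// mulr_ge0 ?sqr_ge0.
have [|N [h0 qh Ke]] := @right_nbhs_mesh _
    (fun h => [/\ 0 < h, q * h <= 1 & h * (K + 1) <= e]) t t0.
  near=> h; split; first by near: h; exact: nbhs_right_gt.
    rewrite -ler_pdivlMl// mulr1; near: h; apply: nbhs_right_le.
    by rewrite invr_gt0.
  rewrite -ler_pdivlMr ?ltr_wpDl//; near: h; apply: nbhs_right_le.
  by rewrite divr_gt0 ?ltr_wpDl.
have := @mesh_mean_le g (t / N.+1%:R) N.+1 k S M (ltW h0) qh uS M0 wM.
have -> : N.+1%:R * (q ^+ 2 * (t / N.+1%:R) ^+ 2 * M) = (t / N.+1%:R) * K.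
  by rewrite /K; field.
have tN : N.+1%:R * (t / N.+1%:R) = t by rewrite mulrC divfK.
rewrite [_ * (_ * L g)]mulrA tN => /le_trans; apply.
rewrite lerD2l (le_trans _ Ke)//.
by rewrite ler_wpM2l ?(ltW h0)// lerDl.
Unshelve. all: by end_near. Qed.

Definition int_ball (k : int) (N : nat) : seq int :=
  [seq k + i%:Z - N%:Z | i <- iota 0 N.*2.+1].

Lemma int_ball_uniq k N : uniq (int_ball k N).
Proof. by rewrite map_inj_uniq ?iota_uniq// => i j; lia. Qed.

Lemma mem_int_ball (k : int) (N : nat) (n : int) :
  `|n - k| <= N%:Z -> n \in int_ball k N.
Proof.
move=> nk; apply/mapP; exists (absz (n - k + N%:Z)); last by lia.
by rewrite mem_iota; lia.
Qed.

(** The gap between [mu] and [L g] absorbs the second-order error for small [h], so [expR (h * mu)]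
    is an admissible one-step factor. The list depends on [t] through the mesh. *)
Lemma perron_mean_ge g mu t k : 0 < t -> mu < L g -> exists2 S : seq int,
  uniq S & expR (t * mu) * w g k <= \sum_(n <- S) p k n t * w g n.
Proof.
move=> t0 muL; pose C := `|q * (L g + q)|.
have C0 : 0 <= C by exact: normr_ge0.
(* For [0 < h <= 1], [D] dominates the second-order coefficient in the product of [1 - h mu] and the
   one-step factor. *)
pose D := C + `|mu| * `|L g| + `|mu| * C + 1.
have D0 : 0 < D by rewrite ltr_wpDl// !addr_ge0 ?mulr_ge0.
have [|N [h0 qh muh]] := @right_nbhs_mesh _ (fun h => [/\ 0 < h, q * h <= 1 &
    expR (h * mu) <= 1 + h * L g - q * h ^+ 2 * (L g + q)]) t t0.
  near=> h; have h0 : 0 < h by near: h; exact: nbhs_right_gt.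
  split => //.
    rewrite -ler_pdivlMl// mulr1; near: h; apply: nbhs_right_le.
    by rewrite invr_gt0.
  have h1 : h <= 1 by near: h; apply: nbhs_right_le.
  have hD : h * D <= L g - mu.
    rewrite -ler_pdivlMr//; near: h; apply: nbhs_right_le.
    by rewrite divr_gt0// subr_gt0.
  have hmu : 0 < 1 - h * mu.
    have hm : h * (`|mu| + 1) <= 1.
      rewrite -ler_pdivlMr ?ltr_wpDl//; near: h; apply: nbhs_right_le.
      by rewrite divr_gt0 ?ltr_wpDl.
    have := ler_wpM2l (ltW h0) (ler_norm mu); lra.
  (* Multiplication by [1 - h * mu] turns the exponential inequality into a polynomial one. *)
  have e1 : (1 - h * mu) * expR (h * mu) <= 1.
    rewrite -ler_pdivlMr ?expR_gt0// mul1r -expRN.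
    exact: expR_ge1Dx.
  rewrite -(ler_pM2l hmu) (le_trans e1)// -subr_ge0.
  pose c := q * (L g + q).
  rewrite (_ : _ - _ = h * (L g - mu - h * (c + mu * L g - h * (mu * c))));
    last by rewrite /c; ring.
  rewrite mulr_ge0 ?(ltW h0)// subr_ge0 (le_trans _ hD)// ler_wpM2l ?(ltW h0)//.
  have cC : c <= C by exact: ler_norm.
  have muLN : mu * L g <= `|mu| * `|L g| by rewrite -normrM ler_norm.
  have : - (h * (mu * c)) <= `|mu| * C.
    apply: le_trans (ler_norm _) _.
    rewrite normrN normrM (gtr0_norm h0) normrM -[`|c|]/C.
    by rewrite ler_piMl// mulr_ge0.
  by rewrite /D; lra.
pose S := int_ball k N.+1.
exists S; first exact: int_ball_uniq.
have := @mesh_mean_ge g (t / N.+1%:R) _ N.+1 k S (ltW h0) qh (expR_ge0 _) muh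
  (int_ball_uniq _ _) (@mem_int_ball k N.+1).
have tN : N.+1%:R * (t / N.+1%:R) = t by rewrite mulrC divfK.
by rewrite -expRM_natl [_ * (_ * mu)]mulrA tN.
Unshelve. all: by end_near. Qed.

End exponential_means.

(** * Chernoff bounds and the local lower bound *)

Section tail_estimates.
Context (R : realType) d (T : measurableType d).
Context (alpha1 alpha2 beta1 beta2 : R).
Context (P : int -> probability T R) (X : R -> {mfun T >-> int}).
Hypotheses (a1 : 0 < alpha1) (a2 : 0 < alpha2) (b1 : 0 < beta1) (b2 : 0 < beta2).
Hypothesis mc : markov_chain P X.
Hypothesis gen :
  has_generator P X (alternating_generator alpha1 alpha2 beta1 beta2).

Local Notation p := (state_prob P X).
Local Notation L := (Lambda alpha1 alpha2 beta1 beta2).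
Local Notation w := (perron_weight alpha1 alpha2 beta1 beta2).
Local Notation slope := (Lambda_slope alpha1 alpha2 beta1 beta2).

(** Chernoff's argument for the weights [w g]: on [S] the tilt may be raised from [g] to [g + th] at
    the price [e^(- th z t)], then the mean at [g + th] is bounded. The sign of [th] selects the
    upper or lower tail. *)
Lemma tilted_tail_le g th k : exists2 D, 0 < D & forall (t z : R) (S : seq int),
  0 <= t -> uniq S -> (forall n, n \in S -> th * z * t <= th * n%:~R) ->
  \sum_(n <- S) p k n t * w g n <= D * expR (t * (L (g + th) - th * z)).
Proof.
have [cg [C [_ C0 wC]]] := perron_weight_bounds a1 a2 b1 b2 g.
have [c [Ch [c0 _ cw]]] := perron_weight_bounds a1 a2 b1 b2 (g + th).
have wk0 := perron_weight_gt0 a1 a2 b1 b2 (g + th) k.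
exists (C / c * w (g + th) k) => [|t z S t0 uS Sz].
  by rewrite mulr_gt0// divr_gt0.
have Cc0 : 0 < C / c by rewrite divr_gt0.
have := perron_mean_le a1 a2 b1 b2 mc gen (g + th) k t0 uS.
set V := \sum_(n <- S) _ => V_le.
apply: (@le_trans _ _ (C / c * expR (- (th * z * t)) * V)); last first.
  rewrite (_ : t * (L (g + th) - th * z) = t * L (g + th) + - (th * z * t)).
    rewrite expRD (_ : _ * (_ * expR _) = C / c * expR (- (th * z * t)) *
      (expR (t * L (g + th)) * w (g + th) k)); last by ring.
    by rewrite ler_wpM2l// mulr_ge0 ?expR_ge0 ?(ltW Cc0).
  by ring.
rewrite mulr_sumr big_seq [leRHS]big_seq; apply: ler_sum => n nS.
rewrite [leRHS]mulrCA ler_wpM2l ?state_prob_ge0//.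
have /andP[_ wn] := wC n; apply: le_trans wn _.
have /andP[cn _] := cw n.
have -> : C * expR (g * n%:~R) =
    C / c * expR (- (th * n%:~R)) * (c * expR ((g + th) * n%:~R)).
  rewrite [RHS]mulrACA divfK ?gt_eqF// -expRD.
  by congr (_ * expR _); ring.
apply: ler_pM => //.
- by rewrite mulr_ge0 ?expR_ge0// ltW.
- by rewrite mulr_ge0 ?expR_ge0// ltW.
- by rewrite ler_pM2l// ler_expR lerN2 Sz.
Qed.

Lemma perron_weight_id n : w 0 n = alpha1 + alpha2.
Proof.
rewrite /perron_weight mul0r oppr0 expR0 mul1r (Lambda0 a1 a2 b1 b2) add0r !mulr1.
by case: ifP.
Qed.

(** At tilt [0] the weight is constant and [L 0 = 0], so the lower bound on exponential means, taken
    at [- (e / t)], bounds the total mass below by [e^-e]. *)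
Lemma mass_exhaustion k t e : 0 < t -> 0 < e ->
  exists2 S : seq int, uniq S & 1 - e <= \sum_(n <- S) p k n t.
Proof.
move=> t0 e0; have et : - (e / t) < L 0.
  by rewrite (Lambda0 a1 a2 b1 b2) oppr_lt0 divr_gt0.
have [S uS HS] := perron_mean_ge a1 a2 b1 b2 mc gen k t0 et; exists S => //.
move: HS; under eq_bigr do rewrite perron_weight_id.
rewrite perron_weight_id -mulr_suml ler_pM2r ?addr_gt0//; apply: le_trans.
by rewrite mulrN mulrC divfK ?gt_eqF//; have := expR_ge1Dx (- e).
Qed.

Lemma event_prob_le_sum k t (B : set int) (S : seq int) : uniq S ->
  fine (P k (X t @^-1` B)) <=
  \sum_(n <- [seq n <- S | n \in B]) p k n t + (1 - \sum_(n <- S) p k n t).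
Proof.
move=> uS; have mX t' (B' : set int) : measurable (X t' @^-1` B').
  exact: measurable_state_event.
rewrite !sum_state_prob ?filter_uniq//.
have -> : 1 - fine (P k (X t @^-1` [set` S])) =
    fine (P k (~` (X t @^-1` [set` S]))).
  by rewrite probability_setC// fineB ?prob_fin_num.
rewrite -fine_prob_disjointU//; first last.
- by rewrite -subset0 => v /= []; rewrite mem_filter => /andP[_ ->].
- exact: measurableC.
apply: fine_prob_le => //; first by apply: measurableU => //; exact: measurableC.
move=> v /= Bv; have [XS|XS] := boolP (X t v \in S); last by right; exact/negP.
by left; rewrite mem_filter XS andbT inE.
Qed.

(** The tilted bound started from tilt [0], restricted to a finite list carrying mass [1 - e]; [e]
    is arbitrary and [D] does not depend on it. *)
Lemma chernoff_le g k : exists2 D, 0 < D & forall (t y : R) (B : set int),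
  0 < t -> (forall n, B n -> g * y * t <= g * n%:~R) ->
  fine (P k (X t @^-1` B)) <= D * expR (- (t * (g * y - L g))).
Proof.
have [D D0 HD] := tilted_tail_le 0 g k.
have aa : 0 < alpha1 + alpha2 by rewrite addr_gt0.
exists (D / (alpha1 + alpha2)) => [|t y B t0 By]; first by rewrite divr_gt0.
apply/ler_addgt0Pr => e e0; have [S uS Se] := mass_exhaustion k t0 e0.
apply: le_trans (event_prob_le_sum k t B uS) _; apply: lerD; last first.
  by rewrite lerBlDr -lerBlDl.
have := HD t y _ (ltW t0) (filter_uniq (mem B) uS).
under eq_bigr do rewrite perron_weight_id.
rewrite -mulr_suml add0r => H.
rewrite -[- (t * _)]mulrN opprB mulrAC ler_pdivlMr//; apply: H => n.
by rewrite mem_filter => /andP[nB _]; apply: By; rewrite inE in nB.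
Qed.

(** The subgradient inequality at the displaced point, tested at [g], bounds the increment by the
    displaced slope, which is within [e] of [slope g] by continuity. *)
Lemma slope_local_bound g e : 0 < e -> exists2 th, 0 < th &
  L (g + th) <= L g + th * (slope g + e) /\
  L (g - th) <= L g - th * (slope g - e).
Proof.
move=> e0; have /(_ g) := Lambda_slope_continuous a1 a2 b1 b2.
move=> /cvgrPdist_lt /(_ e e0).
move=> [r /= r0 Hr]; exists (r / 2); first by rewrite divr_gt0.
have rg : r / 2 < r by rewrite ltr_pdivrMr// mulr_natr mulr2n ltrDl.
have r2 : 0 < r / 2 by rewrite divr_gt0.
have Hr' z : `|g - z| < r -> `|slope g - slope z| < e by exact: Hr.
have : `|slope g - slope (g + r / 2)| < e.
  by apply: Hr'; rewrite opprD addrA subrr add0r normrN gtr0_norm.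
have : `|slope g - slope (g - r / 2)| < e.
  by apply: Hr'; rewrite opprB addrCA subrr addr0 gtr0_norm.
rewrite !ltr_distlC => /andP[l1 l2] /andP[l3 l4].
have s1 := Lambda_subgradient a1 a2 b1 b2 (g + r / 2) g.
have s2 := Lambda_subgradient a1 a2 b1 b2 (g - r / 2) g.
split.
  have : 0 <= r / 2 * (slope g + e - slope (g + r / 2)).
    by rewrite mulr_ge0 ?(ltW r2)// subr_ge0 ltW.
  by lra.
have : 0 <= r / 2 * (slope (g - r / 2) - (slope g - e)).
  by rewrite mulr_ge0 ?(ltW r2)// subr_ge0 ltW.
by lra.
Qed.

(** Under tilt [g] both tails away from [slope g] are exponentially negligible, so at least half of
    the lower bound for the weighted mass comes from the window; removing the tilt there costs the
    factor [e^(t (g y + ep / 2))]. *)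
Lemma local_prob_ge g k (dl ep : R) : 0 < dl -> 0 < ep -> exists2 c, 0 < c &
  \forall t \near +oo, c * expR (- (t * (g * slope g - L g + ep))) <=
    fine (P k (X t @^-1` [set n : int | `|n%:~R / t - slope g| < dl])).
Proof.
move=> dl0 ep0; set y := slope g.
(* In a window of radius [de] around [y] the exponent [g n / t] differs from [g y] by at most
   [ep / 2]. *)
pose de := Num.min dl (ep / (2 * (`|g| + 1))).
have g1 : 0 < `|g| + 1 by rewrite ltr_wpDl.
have de0 : 0 < de by rewrite lt_min dl0 divr_gt0// mulr_gt0.
have de_dl : de <= dl by rewrite ge_min lexx.
have gde : `|g| * de <= ep / 2.
  have : de * (2 * (`|g| + 1)) <= ep.
    by rewrite -ler_pdivlMr ?mulr_gt0// ge_min lexx orbT.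
  by lra.
have de2 : 0 < de / 2 by rewrite divr_gt0.
have [th th0 [Lp Lm]] := slope_local_bound g de2; rewrite -/y in Lp Lm.
(* Both tilted tails are smaller than the total mass by a factor [e^(-t ka)]. *)
pose ka := Num.min (th * de / 4) (ep / 2).
have ka0 : 0 < ka by rewrite lt_min !divr_gt0// mulr_gt0.
have ka1 : ka * 4 <= th * de by rewrite -ler_pdivlMr// ge_min lexx.
have ka2 : ka <= ep / 2 by rewrite ge_min lexx orbT.
have [D1 D10 HD1] := tilted_tail_le g th k.
have [D2 D20 HD2] := tilted_tail_le g (- th) k.
have [cg [C [_ C0 wC]]] := perron_weight_bounds a1 a2 b1 b2 g.
have wk0 := perron_weight_gt0 a1 a2 b1 b2 g k.
pose D := D1 + D2; have D0 : 0 < D by rewrite addr_gt0.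
exists (w g k / (2 * C)); first by rewrite divr_gt0// mulr_gt0.
near=> t.
have t0 : 0 < t by near: t; exact: nbhs_pinfty_gt.
(* For large [t] the tails consume at most half of the initial weight, whence the [2] in the
   constant. *)
have Dt : D * expR (- (t * ka)) <= w g k / 2.
  rewrite expRN ler_pdivrMr ?expR_gt0//.
  apply: (@le_trans _ _ (w g k / 2 * (1 + t * ka))); last first.
    by rewrite ler_wpM2l ?expR_ge1Dx// divr_ge0// ltW.
  rewrite mulrDr mulr1 ler_wpDl ?divr_ge0 ?(ltW wk0)//.
  rewrite mulrCA -ler_pdivrMr; last by rewrite mulr_gt0// divr_gt0.
  by near: t; apply: nbhs_pinfty_ge; exact: num_real.
have mu : L g - ka < L g by rewrite ltrBlDr ltrDl.
have [S uS HS] := perron_mean_ge a1 a2 b1 b2 mc gen k t0 mu.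
set B := [set n : int | _].
pose Sm := [seq n <- S | `|n%:~R / t - y| < de].
pose Sp := [seq n <- S | (y + de) * t <= n%:~R].
pose Sn := [seq n <- S | n%:~R <= (y - de) * t].
have pw n : 0 <= p k n t * w g n.
  by rewrite mulr_ge0 ?state_prob_ge0// ltW ?perron_weight_gt0.
have split3 : \sum_(n <- S) p k n t * w g n <=
    \sum_(n <- Sm) p k n t * w g n + \sum_(n <- Sp) p k n t * w g n +
    \sum_(n <- Sn) p k n t * w g n.
  rewrite !big_filter [X in _ <= X + _ + _]big_mkcond.
  rewrite [X in _ <= _ + X + _]big_mkcond [X in _ <= _ + X]big_mkcond.
  rewrite -!big_split /=; apply: ler_sum => n _.
  have [nm|nm] := boolP (`|n%:~R / t - y| < de).
    by rewrite -addrA lerDl addr_ge0//; case: ifP.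
  have [np|np] := boolP ((y + de) * t <= n%:~R).
    by rewrite add0r lerDl; case: ifP.
  rewrite !add0r ifT//; move: nm np; rewrite -ltNge -ler_pdivrMr//.
  rewrite -ltr_pdivrMr// ltr_distl negb_and -!leNgt => /orP[|h1 h2]; first by [].
  by have := lt_le_trans h2 h1; rewrite ltxx.
have tail1 : \sum_(n <- Sp) p k n t * w g n <= D1 * expR (t * (L g - 2 * ka)).
  apply: (le_trans (HD1 t (y + de) Sp (ltW t0) _ _)).
  - exact: filter_uniq.
  - by move=> n; rewrite mem_filter => /andP[H _]; rewrite -mulrA ler_pM2l.
  rewrite ler_pM2l// ler_expR ler_pM2l//; lra.
have tail2 : \sum_(n <- Sn) p k n t * w g n <= D2 * expR (t * (L g - 2 * ka)).
  apply: (le_trans (HD2 t (y - de) Sn (ltW t0) _ _)).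
  - exact: filter_uniq.
  - move=> n; rewrite mem_filter => /andP[H _].
    by rewrite -mulrA !mulNr lerN2 ler_pM2l.
  rewrite ler_pM2l// ler_expR ler_pM2l//; lra.
have main : \sum_(n <- Sm) p k n t * w g n <=
    C * expR (t * (g * y + ep / 2)) * fine (P k (X t @^-1` B)).
  apply: (@le_trans _ _
    (\sum_(n <- Sm) p k n t * (C * expR (t * (g * y + ep / 2))))).
    rewrite big_seq [leRHS]big_seq; apply: ler_sum => n.
    rewrite mem_filter => /andP[nt _]; rewrite ler_wpM2l ?state_prob_ge0//.
    have /andP[_ /le_trans] := wC n; apply; rewrite ler_pM2l// ler_expR.
    have -> : g * n%:~R = t * (g * y + g * (n%:~R / t - y)).
      by field; exact: lt0r_neq0.
    rewrite ler_pM2l// lerD2l (le_trans (ler_norm _))// normrM (le_trans _ gde)//.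
    by rewrite ler_wpM2l// ltW.
  rewrite -mulr_suml mulrC ler_wpM2l ?mulr_ge0 ?expR_ge0 ?(ltW C0)//.
  rewrite sum_state_prob ?filter_uniq//.
  apply: fine_prob_le; [exact: measurable_state_event..|].
  move=> v /=; rewrite mem_filter => /andP[/lt_le_trans H _]; exact: H.
have total := le_trans HS (le_trans split3 (lerD (lerD main tail1) tail2)).
rewrite -[leRHS]addrA -mulrDl -/D in total.
have e1 : expR (t * (L g - 2 * ka)) = expR (t * (L g - ka)) * expR (- (t * ka)).
  by rewrite -expRD; congr expR; ring.
have h1 : D * expR (t * (L g - 2 * ka)) <= expR (t * (L g - ka)) * (w g k / 2).
  by rewrite e1 mulrCA ler_wpM2l ?expR_ge0.
have h2 : expR (t * (L g - ka)) * (w g k / 2) <=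
    C * expR (t * (g * y + ep / 2)) * fine (P k (X t @^-1` B)) by lra.
rewrite -(@ler_pM2l _ (C * expR (t * (g * y + ep / 2)))) ?mulr_gt0 ?expR_gt0//.
apply: le_trans h2.
have -> : C * expR (t * (g * y + ep / 2)) * (w g k / (2 * C) *
    expR (- (t * (g * y - L g + ep)))) = expR (t * (g * y + ep / 2)) *
    expR (- (t * (g * y - L g + ep))) * (w g k / 2).
  by field; exact: lt0r_neq0.
rewrite -expRD ler_wpM2r ?divr_ge0 ?(ltW wk0)// ler_expR.
have -> : t * (g * y + ep / 2) + - (t * (g * y - L g + ep)) = t * (L g - ep / 2).
  by field.
by rewrite ler_pM2l// lerD2l lerN2.
Unshelve. all: by end_near. Qed.

End tail_estimates.

(** * Limits on the logarithmic scale and extremal points of closed sets *)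

Section exponential_rates.
Context (R : realType).
Implicit Types (f : R -> \bar R) (F : set_system R) (a c e t : R).

Lemma limf_esup_le f F (x : \bar R) {FF : Filter F} :
  (\forall t \near F, (f t <= x)%E) -> (limf_esup f F <= x)%E.
Proof.
move=> Fx; rewrite limf_esupE; apply: ge_ereal_inf.
exists (ereal_sup (f @` [set t | (f t <= x)%E])).
  by exists [set t | (f t <= x)%E].
by apply: ge_ereal_sup => _ [t ? <-].
Qed.

Lemma limf_einf_ge f F (x : \bar R) {FF : Filter F} :
  (\forall t \near F, (x <= f t)%E) -> (x <= limf_einf f F)%E.
Proof.
move=> Fx; rewrite /limf_einf leeNr; apply: limf_esup_le.
by apply: filterS Fx => t; rewrite leeN2.
Qed.

(** Reduces an upper bound by [- x] to real levels below [x], so that an infinite infimum of the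
    rate function is covered too. *)
Lemma le_oppe_dense (x y : \bar R) :
  (forall a, (a%:E < x)%E -> (y <= (- a)%:E)%E) -> (y <= - x)%E.
Proof.
case: x => [r|H|_] /=; last by rewrite leey.
  move=> H; apply/lee_addgt0Pr => e e0.
  by have := H (r - e); rewrite lte_fin ltrBlDr ltrDl opprB addrC => /(_ e0).
case: y H => [s| |] // H; last by have := H 0 (ltry _).
by have := H (1 - s)%R (ltry _); rewrite lee_fin opprB => ?; exfalso; lra.
Qed.

Lemma log_rate_ge t a (x : R) : 0 < t -> expR (- (t * a)) <= x ->
  ((- a)%:E <= t^-1%:E * lne x%:E)%E.
Proof.
move=> t0 ax; have x0 : 0 < x by apply: lt_le_trans ax; exact: expR_gt0.
rewrite lne_EFin// -EFinM lee_fin ler_pdivlMl// mulrN.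
by rewrite -[leLHS]expRK ler_ln ?posrE// expR_gt0.
Qed.

Lemma log_rate_le t a (x : R) : 0 < t -> 0 <= x -> x <= expR (- (t * a)) ->
  (t^-1%:E * lne x%:E <= (- a)%:E)%E.
Proof.
move=> t0; rewrite le_eqVlt => /orP[/eqP<- _|x0 xa].
  (* A null event has logarithm [-oo], which lies below every bound. *)
  by rewrite le0_lneNy// gt0_muleNy ?lte_fin ?invr_gt0// leNye.
rewrite lne_EFin// -EFinM lee_fin ler_pdivrMl// mulrN.
by rewrite -[leRHS]expRK ler_ln ?posrE// expR_gt0.
Qed.

(** Constant prefactors are invisible on the exponential scale; [1 + t e] below the exponential
    already suffices. *)
Lemma near_pinfty_absorb c e : 0 < c -> 0 < e ->
  \forall t \near +oo, 1 <= c * expR (t * e).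
Proof.
move=> c0 e0; near=> t.
apply: (@le_trans _ _ (c * (1 + t * e))); last first.
  by rewrite ler_pM2l// expR_ge1Dx.
rewrite mulrDr mulr1 ler_wpDl ?(ltW c0)// mulrCA.
rewrite -ler_pdivrMr; last exact: mulr_gt0.
by near: t; apply: nbhs_pinfty_ge; exact: num_real.
Unshelve. all: by end_near. Qed.

Lemma closed_min (A : set R) (m : R) : closed A -> A !=set0 ->
  (forall x, A x -> m <= x) -> exists2 y, A y & forall x, A x -> y <= x.
Proof.
move=> cA [x0 Ax0] mA; pose B := `[m, x0] `&` A.
have cB : compact B by apply: compact_closedI => //; exact: segment_compact.
have Bx0 : B x0 by split => //=; rewrite in_itv/= mA//= lexx.
have [||y + yB] := @compact_EVT_min _ R id B _ cB; first by exists x0.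
  by apply: continuous_subspaceT => x; exact: cvg_id.
rewrite inE => -[+ Ay]; rewrite /= in_itv/= => /andP[_ yx0].
exists y => // x Ax; have [xx0|/ltW x0x] := lerP x x0; last exact: le_trans x0x.
by apply: yB; rewrite inE; split => //=; rewrite in_itv/= mA.
Qed.

Lemma closed_max (A : set R) (m : R) : closed A -> A !=set0 ->
  (forall x, A x -> x <= m) -> exists2 y, A y & forall x, A x -> x <= y.
Proof.
move=> cA [x0 Ax0] mA.
have [|||y Ay yA] := @closed_min (-%R @^-1` A) (- m).
- by apply: preimage_closed => // x _; exact: opp_continuous.
- by exists (- x0) => /=; rewrite opprK.
- by move=> x /= /mA; rewrite lerNl.
- by exists (- y) => // x Ax; rewrite lerNr yA//= opprK.
Qed.

End exponential_rates.

(** * The rate function and the two large deviation bounds *)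

Section large_deviations_principle.
Context (R : realType) d (T : measurableType d).
Context (alpha1 alpha2 beta1 beta2 : R).
Context (P : int -> probability T R) (X : R -> {mfun T >-> int}).
Hypotheses (a1 : 0 < alpha1) (a2 : 0 < alpha2) (b1 : 0 < beta1) (b2 : 0 < beta2).

Local Notation L := (Lambda alpha1 alpha2 beta1 beta2).
Local Notation I := (legendre L).
Local Notation slope := (Lambda_slope alpha1 alpha2 beta1 beta2).

Lemma legendre_ge (g y : R) : ((g * y - L g)%:E <= I y)%E.
Proof. by apply: ereal_sup_ubound; exists g. Qed.

Lemma legendre_gt (a y : R) : (a%:E < I y)%E -> exists g, a < g * y - L g.
Proof. by move=> /ereal_sup_gt[_ [g _ <-]]; rewrite lte_fin; exists g. Qed.

(** The subgradient inequality says that the supremum is attained at [g]. *)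
Lemma legendre_slope g : I (slope g) = (g * slope g - L g)%:E.
Proof.
apply/le_anti/andP; split; last exact: legendre_ge.
apply: ge_ereal_sup => _ [h _ <-]; rewrite lee_fin.
by have := Lambda_subgradient a1 a2 b1 b2 g h; lra.
Qed.

Lemma legendre_ge0 y : (0 <= I y)%E.
Proof.
by apply: le_trans (legendre_ge 0 y); rewrite mul0r (Lambda0 a1 a2 b1 b2) subrr.
Qed.

Lemma legendre_lsc : lower_semicontinuous I.
Proof.
move=> y a /legendre_gt[g ag].
have : g * x - L g @[x --> y] --> g * y - L g.
  by apply: cvgB; [apply: cvgMr; exact: cvg_id|exact: cvg_cst].
move=> /cvgr_gt /(_ a ag) ya; exists [set x | a < g * x - L g] => // x /= ax.
by apply: lt_le_trans (legendre_ge g x); rewrite lte_fin.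
Qed.

(** Testing the supremum at [1] and [- 1] confines a level set to a segment; lower semicontinuity
    makes it closed. *)
Lemma legendre_good : good_rate I.
Proof.
move=> eta _; pose M := eta + Num.max (L 1) (L (- 1)).
apply: (@subclosed_compact _ _ `[- M, M]%classic); last 2 first.
- exact: segment_compact.
- move=> y /= Iy; rewrite in_itv/=.
  have := le_trans (legendre_ge 1 y) Iy; have := le_trans (legendre_ge (- 1) y) Iy.
  have : L 1 <= Num.max (L 1) (L (- 1)) by rewrite le_max lexx.
  have : L (- 1) <= Num.max (L 1) (L (- 1)) by rewrite le_max lexx orbT.
  by rewrite !lee_fin /M => ? ? ? ?; apply/andP; split; lra.
rewrite (_ : [set y | _] = ~` [set y | (eta%:E < I y)%E]).
  have /lower_semicontinuousP lsc := legendre_lsc.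
  by apply: open_closedC; exact: lsc.
by apply/seteqP; split => y /=; [rewrite leNgt => /negP|move/negP; rewrite -leNgt].
Qed.

Hypothesis mc : markov_chain P X.
Hypothesis gen :
  has_generator P X (alternating_generator alpha1 alpha2 beta1 beta2).

Lemma scaled_lawE k (A : set R) :
  (fun t : R => (t^-1)%:E * lne (scaled_law P X k t A))%E =
  (fun t : R => (t^-1)%:E *
    lne (fine (P k (X t @^-1` [set n : int | A (n%:~R / t)])))%:E)%E.
Proof.
apply/funext => t; rewrite fineK// prob_fin_num//.
exact: measurable_state_event.
Qed.

Lemma scaled_law_lower k (O : set R) : open O ->
  (- ereal_inf (I @` O) <=
    limf_einf (fun t : R => (t^-1)%:E * lne (scaled_law P X k t O)) +oo%R)%E.
Proof.
move=> oO; rewrite scaled_lawE leeNl; apply: le_ereal_inf_tmp => _ [y Oy <-].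
rewrite leeNl; have [g gy] := Lambda_slope_surj a1 a2 b1 b2 y.
rewrite -gy legendre_slope; apply/lee_addgt0Pr => e e0; rewrite -leeBlDr//.
have [r /= r0 rO] : nbhs y O by exact: open_nbhs_nbhs.
(* One half of [e] is spent in the local bound, the other absorbs its constant [c]. *)
have e2 : 0 < e / 2 by rewrite divr_gt0.
have [c c0 Pc] := local_prob_ge a1 a2 b1 b2 mc gen g k r0 e2.
apply: limf_einf_ge; near=> t.
have t0 : 0 < t by near: t; exact: nbhs_pinfty_gt.
have ct : 1 <= c * expR (t * (e / 2)).
  by near: t; exact: near_pinfty_absorb.
have : c * expR (- (t * (g * slope g - L g + e / 2))) <=
    fine (P k (X t @^-1` [set n : int | `|n%:~R / t - slope g| < r])).
  by near: t.
move=> Pt; rewrite -EFinD -opprD; apply: log_rate_ge => //.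
apply: (@le_trans _ _ (c * expR (- (t * (g * slope g - L g + e / 2))))).
  rewrite (_ : - (t * (g * slope g - L g + e)) =
    - (t * (g * slope g - L g + e / 2)) - t * (e / 2)); last by field.
  by rewrite expRD mulrC ler_pM2r ?expR_gt0// expRN -div1r ler_pdivrMr ?expR_gt0.
apply: le_trans Pt _; apply: fine_prob_le; [exact: measurable_state_event..|].
by move=> v /= vr; apply: rO; rewrite /= distrC -gy.
Unshelve. all: by end_near. Qed.

(** [C] is cut at [m = slope 0]; on each side Chernoff's inequality is applied at the point of [C]
    nearest to [m], with a tilt pointing away from [m]. *)
Lemma closed_prob_le k (C : set R) (a : R) : closed C ->
  (forall y, C y -> (a%:E < I y)%E) -> exists2 D, 0 < D & forall t, 0 < t ->
  fine (P k (X t @^-1` [set n : int | C (n%:~R / t)])) <= D * expR (- (t * a)).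
Proof.
move=> cC aC; pose E (A : set R) t := X t @^-1` [set n : int | A (n%:~R / t)].
have mE A t : measurable (E A t) by exact: measurable_state_event.
(* For negative [a] the bound exceeds [1] and holds for any event. *)
have [a_lt0|a_ge0] := ltrP a 0.
  exists 1 => // t t0; rewrite mul1r.
  apply: (@le_trans _ _ 1); last first.
    by rewrite -expR0 ler_expR oppr_ge0 nmulr_lle0// ltW.
  rewrite -[leRHS]/(fine 1%:E) -(probability_setT (P k)).
  exact: fine_prob_le (mE C t) _ _.
pose m := slope 0.
have mL g : g * m <= L g.
  have := Lambda_subgradient a1 a2 b1 b2 0 g.
  by rewrite (Lambda0 a1 a2 b1 b2) add0r subr0 mulrC.
have ray (A : set R) y g : a < g * y - L g -> (forall x, A x -> g * y <= g * x) ->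
    exists2 D, 0 < D & forall t, 0 < t ->
    fine (P k (E A t)) <= D * expR (- (t * a)).
  move=> ag Ag; have [D D0 HD] := chernoff_le a1 a2 b1 b2 mc gen g k.
  exists D => // t t0.
  apply: le_trans (HD t y [set n : int | A (n%:~R / t)] t0 _) _.
    by move=> n /= /Ag; rewrite mulrA ler_pdivlMr.
  by rewrite ler_pM2l// ler_expR lerN2 ler_pM2l// ltW.
(* On the empty set the ray condition is vacuous; tilt [1] at the point [a + L 1 + 1] gives the
   value [a + 1]. *)
have empty A : A = set0 -> exists2 D, 0 < D & forall t, 0 < t ->
    fine (P k (E A t)) <= D * expR (- (t * a)).
  by move=> ->; apply: (@ray _ (a + L 1 + 1) 1) => [|x []]; lra.
have [D1 D10 H1] : exists2 D, 0 < D & forall t, 0 < t ->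
    fine (P k (E (C `&` [set x | m <= x]) t)) <= D * expR (- (t * a)).
  have [/empty//|/set0P ne] := eqVneq (C `&` [set x | m <= x]) set0.
  have [||y [Cy my] yC] := @closed_min _ (C `&` [set x | m <= x]) m _ ne.
  - by apply: closedI => //; exact: closed_ge.
  - by move=> x [].
  have [g ag] := legendre_gt (aC y Cy); apply: (ray _ y g ag) => x /yC yx.
  (* A negative [g] would give [g * y <= g * m <= L g], against [0 <= a < g * y - L g]. *)
  rewrite ler_wpM2l// leNgt; apply/negP => g0; have := mL g.
  have : g * y <= g * m by rewrite ler_nM2l.
  by lra.
have [D2 D20 H2] : exists2 D, 0 < D & forall t, 0 < t ->
    fine (P k (E (C `&` [set x | x <= m]) t)) <= D * expR (- (t * a)).
  have [/empty//|/set0P ne] := eqVneq (C `&` [set x | x <= m]) set0.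
  have [||y [Cy my] yC] := @closed_max _ (C `&` [set x | x <= m]) m _ ne.
  - by apply: closedI => //; exact: closed_le.
  - by move=> x [].
  have [g ag] := legendre_gt (aC y Cy); apply: (ray _ y g ag) => x /yC xy.
  rewrite ler_wnM2l// leNgt; apply/negP => g0; have := mL g.
  have : g * y <= g * m by rewrite ler_pM2l.
  by lra.
exists (D1 + D2); first by rewrite addr_gt0.
move=> t t0; rewrite mulrDl; apply: le_trans (lerD (H1 t t0) (H2 t t0)).
rewrite -fineD ?prob_fin_num//; apply: fine_le.
- by rewrite prob_fin_num//; exact: mE.
- by rewrite fin_numD !prob_fin_num.
apply: le_trans (measureU2 _ _ _) => //; apply: le_measure; rewrite ?inE//.
- exact: (mE C t).
- exact: measurableU.
by move=> v /= Cv; have [mv|/ltW vm] := lerP m ((X t v)%:~R / t); [left|right].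
Qed.

(** Every real [a] below the infimum of the rate over [C] is an exponential decay rate for [C], up
    to a constant that the slack [e] absorbs. *)
Lemma scaled_law_upper k (C : set R) : closed C ->
  (limf_esup (fun t : R => (t^-1)%:E * lne (scaled_law P X k t C)) +oo%R <=
    - ereal_inf (I @` C))%E.
Proof.
move=> cC; rewrite scaled_lawE; apply: le_oppe_dense => a aI.
apply/lee_addgt0Pr => e e0; rewrite -EFinD.
have [y Cy|D D0 HD] := closed_prob_le k cC (a := a).
  by apply: lt_le_trans aI _; apply: ereal_inf_lbound; exists y.
apply: limf_esup_le; near=> t.
have t0 : 0 < t by near: t; exact: nbhs_pinfty_gt.
rewrite -[in (- a + e)](opprK e) -opprD; apply: log_rate_le => //.
  exact: fine_prob_ge0.
apply: (le_trans (HD t t0)).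
have Dt : 1 <= D^-1 * expR (t * e).
  by near: t; apply: near_pinfty_absorb; rewrite ?invr_gt0.
rewrite mulrBr opprB expRD [leLHS]mulrC [leRHS]mulrC ler_pM2l ?expR_gt0//.
by move: Dt; rewrite ler_pdivlMl// mulr1.
Unshelve. all: by end_near. Qed.

End large_deviations_principle.

Theorem proposition3p3 (R : realType) (d : measure_display) (T : measurableType d)
    (alpha1 alpha2 beta1 beta2 : R)
    (P : int -> probability T R) (X : R -> {mfun T >-> int}) :
  0 < alpha1 -> 0 < alpha2 -> 0 < beta1 -> 0 < beta2 ->
  markov_chain P X ->
  has_generator P X (alternating_generator alpha1 alpha2 beta1 beta2) ->
  forall k : int,
    satisfies_LDP (scaled_law P X k) (fun t : R => t)
      (legendre (Lambda alpha1 alpha2 beta1 beta2)) /\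
    good_rate (legendre (Lambda alpha1 alpha2 beta1 beta2)).
Proof.
move=> a1 a2 b1 b2 mc gen k; split; last exact: legendre_good.
split.
- exact: cvg_id.
- exact: legendre_ge0.
- exact: legendre_lsc.
- by move=> O oO; exact: (scaled_law_lower a1 a2 b1 b2 mc gen).
- by move=> C cC; exact: (scaled_law_upper a1 a2 b1 b2 mc gen).
Qed.
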